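(* A positive semiring $S$ is a bi-UFS if and only if $S=\mathbb{N}_0$.
   Context: Here $\mathbb{N}_0=\{0,1,2,\dots\}$. A positive semiring is a subset $S$ of $\mathbb{R}_{\ge 0}$ that contains $0$ and $1$ and is closed under the usual addition and multiplication. Write $S^\bullet=S\setminus\{0\}$; then $(S,+)$ and $(S^\bullet,\cdot)$ are monoids, where ''monoid'' means a cancellative, commutative semigroup with identity. An atom of a monoid is a nonunit that is not a product (a sum, if the monoid is written additively) of two nonunits. A monoid is a UFM (unique factorization, or factorial, monoid) if each nonunit has exactly one factorization into finitely many atoms, up to order and associates. A positive semiring $S$ is a bi-UFS if both $(S,+)$ and $(S^\bullet,\cdot)$ are UFMs. *)

(* Defs.v *)
From HB Require Import structures.
From mathcomp Require Import all_boot all_order all_algebra.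
From mathcomp Require Import all_classical all_reals.

Set Implicit Arguments.
Unset Strict Implicit.
Unset Printing Implicit Defensive.

Import Order.TTheory GRing.Theory Num.Theory.

Local Open Scope classical_set_scope.
Local Open Scope ring_scope.

(* Monoids are represented as subsets M of an ambient type T on which [op] is
   an associative and commutative law with neutral element e. *)
Section Monoids.
Context (T : eqType) (e : T) (op : Monoid.com_law e) (M : set T).

Record cancellative_monoid : Prop := CancellativeMonoid {
  cmonoid_id : M e;
  cmonoid_op : forall x y, M x -> M y -> M (op x y);
  cmonoid_cancel : forall x y z, M x -> M y -> M z ->
    op x y = op x z -> y = z }.

(* Units are invertible inside M, not merely in T. *)
Definition munit (x : T) : Prop :=
  M x /\ exists2 y, M y & op x y = e.

Definition mnonunit (x : T) : Prop := M x /\ ~ munit x.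

Definition matom (x : T) : Prop :=
  mnonunit x /\ ~ exists y z, [/\ mnonunit y, mnonunit z & x = op y z].

Definition massociate (x y : T) : Prop :=
  exists2 u, munit u & x = op u y.

Definition mfactorization (x : T) (s : seq T) : Prop :=
  (forall a, a \in s -> matom a) /\ x = \big[op/e]_(a <- s) a.

Definition same_factorization (s t : seq T) : Prop :=
  exists s', [/\ perm_eq s s', size s' = size t &
    forall i, (i < size t)%N -> massociate (nth e s' i) (nth e t i)].

Definition UFM : Prop :=
  cancellative_monoid /\
  forall x, mnonunit x ->
    exists2 s, mfactorization x s &
      forall t, mfactorization x t -> same_factorization s t.

End Monoids.

Section PositiveSemirings.
Context (R : realType) (S : set R).

Record positive_semiring : Prop := PositiveSemiring {
  psemiring_ge0 : forall x, S x -> 0 <= x;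
  psemiring0 : S 0;
  psemiring1 : S 1;
  psemiringD : forall x y, S x -> S y -> S (x + y);
  psemiringM : forall x y, S x -> S y -> S (x * y) }.

Definition bi_UFS : Prop :=
  UFM (+%R : Monoid.com_law (0 : R)) S /\
  UFM ( *%R : Monoid.com_law (1 : R)) (S `\ 0).

End PositiveSemirings.

(* Main.v *)
Require Import Defs.
From mathcomp Require Import all_boot all_order all_algebra.
From mathcomp Require Import all_classical all_reals.
From mathcomp Require Import ring zify.
Import Order.TTheory GRing.Theory Num.Theory.
Local Open Scope classical_set_scope.
Local Open Scope ring_scope.

Set Implicit Arguments.
Unset Strict Implicit.
Unset Printing Implicit Defensive.

(* Let A be the set of additive atoms of a bi-UFS S, and write u <= v when
   v - u lies in S; then 1 is in A. Atoms of factorial monoids are prime, so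
   t * q in S and q ^ 2 in S with t in S nonzero imply q in S.

   If a, b, y are additive atoms, y is not 1, a or b, and y <= a * b, let t be
   the sum (1 + a + b) ^ 6 with all its summands y removed. Every atom of y * t
   is in the support of t ^ 2, so q = N t - y satisfies t q, q ^ 2 in S for
   large N; hence q in S and y <= N t, a contradiction. So the support of a * b
   is contained in {1, a, b}. It follows that A has at most one element x other
   than 1, and applying the same principle to 2 x - 1 yields x ^ 2 = n for a
   natural number n. Then a prime number l dividing n ^ 2 + n + 1 is a
   multiplicative atom of S that is not prime, so A = {1}. *)

(** * Divisibility in factorial monoids *)

Definition mdvd {T : eqType} {e : T} (op : Monoid.com_law e) (M : set T)
  (x y : T) : Prop := exists2 z, M z & y = op x z.

Section UFMTheory.
Context {T : eqType} {e : T} (op : Monoid.com_law e) (M : set T).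
Hypothesis ufmM : UFM op M.

Let opA : associative op := Monoid.mulmA op.
Let opC : commutative op := Monoid.mulmC op.
Let opAC : right_commutative op := Monoid.mulmAC op.
Let opCA : left_commutative op := Monoid.mulmCA op.
Let op1x : left_id e op := Monoid.mul1m op.
Let opx1 : right_id e op := Monoid.mulm1 op.
Let M1 : M e := cmonoid_id ufmM.1.
Let Mop {x y} : M x -> M y -> M (op x y).
Proof. exact: (cmonoid_op ufmM.1). Qed.
Let opI {x y z} : M x -> M y -> M z -> op x y = op x z -> y = z.
Proof. exact: (cmonoid_cancel ufmM.1). Qed.

Lemma munit_divl x y : M x -> M y -> munit op M (op x y) -> munit op M x.
Proof.
move=> Mx My [_ [z Mz xyz]]; split=> //; exists (op y z); first exact: Mop.
by rewrite opA.
Qed.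

Lemma mdvd_unit u x : munit op M u -> M x -> mdvd op M u x.
Proof.
move=> [_ [v Mv uv]] Mx; exists (op v x); first exact: Mop.
by rewrite opA uv op1x.
Qed.

Lemma mdvd_opr x y z : M z -> mdvd op M x y -> mdvd op M x (op y z).
Proof.
move=> Mz [w Mw ->]; exists (op w z); first exact: Mop.
by rewrite opA.
Qed.

Lemma big_atoms_closed s : (forall a, a \in s -> matom op M a) ->
  M (\big[op/e]_(a <- s) a).
Proof.
move=> sA; rewrite big_seq; elim/big_rec: _ => // a x /sA[[Ma _] _] Mx.
exact: Mop.
Qed.

Lemma mdvd_big s a : (forall c, c \in s -> matom op M c) -> a \in s ->
  mdvd op M a (\big[op/e]_(c <- s) c).
Proof.
move=> sA a_s; rewrite (big_rem a)//=; eexists; last by [].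
by apply: big_atoms_closed => c /mem_rem; exact: sA.
Qed.

Lemma same_factorization_assoc s t a : a \in t -> same_factorization op M s t ->
  exists2 c, c \in s & massociate op M c a.
Proof.
move=> a_t [s' [ss' sz ass]]; exists (nth e s' (index a t)).
  by rewrite (perm_mem ss') mem_nth// sz index_mem.
by have := ass (index a t); rewrite index_mem nth_index//; apply.
Qed.

(** Factor the cofactor [z] and prepend [p]: uniqueness makes [p] an associate of an atom in the
    concatenated factorizations of [f] and [g]. Units have no prescribed factorization and are
    treated first. *)
Lemma matom_prime p f g : matom op M p -> M f -> M g ->
  mdvd op M p (op f g) -> mdvd op M p f \/ mdvd op M p g.
Proof.
move=> pA Mf Mg [z Mz fgE]; have [[Mp pNU] pI] := pA.
have [[_ [f' Mf' ff']]|fNU] := pselect (munit op M f).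
  right; exists (op z f'); first exact: Mop.
  by rewrite opA -fgE opAC ff' op1x.
have [[_ [g' Mg' gg']]|gNU] := pselect (munit op M g).
  left; exists (op z g'); first exact: Mop.
  by rewrite opA -fgE -opA gg' opx1.
(* A unit [z] would turn [p] into a product of the nonunits [f] and [g * z']. *)
have [[_ [z' Mz' zz']]|zNU] := pselect (munit op M z).
  case: pI; exists f, (op g z'); split=> //.
    by split; [exact: Mop|move=> /(munit_divl Mg Mz')/gNU].
  by rewrite opA fgE -opA zz' opx1.
have [sf [sfA fE] _] := ufmM.2 f (conj Mf fNU).
have [sg [sgA gE] _] := ufmM.2 g (conj Mg gNU).
have [sz [szA zE] _] := ufmM.2 z (conj Mz zNU).
have [|s _ sU] := ufmM.2 (op f g).
  by split; [exact: Mop|move=> /(munit_divl Mf Mg)/fNU].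
(* Uniqueness compares every factorization with one reference [s] only, so [p] is matched first with
   some [c] in [s], and [c] then with some [h] in [sf ++ sg]. *)
have /(same_factorization_assoc (mem_head _ _))[c c_s [u [Mu _] cE]] :
    same_factorization op M s (p :: sz).
  apply: sU; split; last by rewrite big_cons -zE.
  by move=> a; rewrite inE => /predU1P[->//|/szA].
have fgA a : a \in sf ++ sg -> matom op M a.
  by rewrite mem_cat => /orP[/sfA|/sgA].
have /sU[s' [ss' szs' ass]] : mfactorization op M (op f g) (sf ++ sg).
  by split=> //; rewrite big_cat -fE -gE.
have c_s' : c \in s' by rewrite -(perm_mem ss').
pose h := nth e (sf ++ sg) (index c s').
have ltc : (index c s' < size (sf ++ sg))%N by rewrite -szs' index_mem.
have h_fg : h \in sf ++ sg by exact: mem_nth.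
have ph : mdvd op M p h.
  have := ass _ ltc; rewrite nth_index// => -[v [_ [v' Mv' vv']] cE'].
  exists (op v' u); first exact: Mop.
  rewrite opC -opA -cE cE' opA.
  by rewrite [op v' v]opC vv' op1x.
have ph_big s0 : (forall a, a \in s0 -> matom op M a) -> h \in s0 ->
    mdvd op M p (\big[op/e]_(c <- s0) c).
  by move=> sA /(mdvd_big sA)[k Mk ->]; exact: mdvd_opr.
move: h_fg; rewrite mem_cat fE gE.
by move=> /orP[]; [left|right]; exact: ph_big.
Qed.

(** Induction on the atoms of [t]: an atom [p] of [t] is prime and divides [w * w], so it divides
    [w], and [p * p] cancels from both sides. *)
Lemma mdvd_root t u w : M t -> M u -> M w ->
  op (op t t) u = op w w -> mdvd op M t w.
Proof.
move=> Mt Mu Mw; have [tU _|tNU] := pselect (munit op M t).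
  exact: mdvd_unit.
have [s [sA ->] _] := ufmM.2 t (conj Mt tNU).
elim: s w sA Mw {t Mt tNU} => [|p s IH] w sA Mw.
  by rewrite big_nil => _; exists w => //; rewrite op1x.
rewrite big_cons; set t := \big[_/_]_(a <- s) a => tuw.
have sA' a : a \in s -> matom op M a.
  by move=> a_s; apply: sA; rewrite inE a_s orbT.
have Mt : M t by exact: big_atoms_closed.
have pA : matom op M p by apply: sA; rewrite mem_head.
have Mp : M p by case: pA => -[].
have [v Mv wE] : mdvd op M p w.
  have [] // : mdvd op M p w \/ mdvd op M p w.
  apply: (matom_prime pA) => //; rewrite -tuw.
  exists (op t (op (op p t) u)); first by do !apply: Mop.
  by rewrite !opA.
have [|z Mz vE] := IH v sA' Mv.
  have ptu : op p (op p (op (op t t) u)) = op p (op p (op v v)).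
    have <- : op w w = op p (op p (op v v)).
      by rewrite wE -[LHS]opA [op v _]opCA.
    rewrite -tuw -!opA; congr (op p _).
    by rewrite opCA.
  by apply: (opI Mp) _ _ (opI Mp _ _ ptu); do !apply: Mop.
by exists z => //; rewrite wE vE opA.
Qed.

End UFMTheory.

(** * The additive order of a bi-UFS and its atoms *)

Section BiUFS.
Context {R : realType} (S : set R).
Hypothesis hS : positive_semiring S.
Hypothesis hU : bi_UFS S.

Local Notation add := (+%R : Monoid.com_law (0 : R)).
Local Notation mul := ( *%R : Monoid.com_law (1 : R)).
Local Notation "x <<= y" := (S (y - x)) (at level 70).

Let S_ge0 {x} : S x -> 0 <= x. Proof. exact: (psemiring_ge0 hS). Qed.
Let S0 : S 0 := psemiring0 hS.
Let S1 : S 1 := psemiring1 hS.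
Let SD {x y} : S x -> S y -> S (x + y). Proof. exact: (psemiringD hS). Qed.
Let SM {x y} : S x -> S y -> S (x * y). Proof. exact: (psemiringM hS). Qed.

Lemma psemiringMn x n : S x -> S (x *+ n).
Proof. by move=> Sx; elim: n => [|n IH]; rewrite ?mulr0n// mulrS; exact: SD. Qed.

Lemma psemiringX x n : S x -> S (x ^+ n).
Proof. by move=> Sx; elim: n => [|n IH]; rewrite ?expr0// exprS; exact: SM. Qed.

Lemma munit_add x : munit add S x <-> x = 0.
Proof.
split=> [[Sx [y Sy /= /eqP]]|->].
  by rewrite paddr_eq0 ?S_ge0// => /andP[/eqP].
by split=> //; exists 0 => //=; rewrite addr0.
Qed.

(** Carries primality of atoms over to [<<=]; the only possible cofactor is the real difference. *)
Lemma mdvd_add x y : mdvd add S x y <-> x <<= y.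
Proof.
split=> [[z Sz ->]|Sxy]; first by rewrite /= [x + z]addrC addrK.
by exists (y - x) => //=; rewrite addrC subrK.
Qed.

Lemma add_atom_closed y : matom add S y -> S y. Proof. by case=> -[]. Qed.

Lemma add_atom_neq0 y : matom add S y -> y != 0.
Proof. by move=> [[_ yNU] _]; apply/eqP => /munit_add. Qed.

Lemma add_atom_gt0 y : matom add S y -> 0 < y.
Proof.
by move=> yA; rewrite lt0r add_atom_neq0//= S_ge0//; exact: add_atom_closed.
Qed.

Lemma add_atom_eq y a : matom add S y -> matom add S a -> y <<= a -> y = a.
Proof.
move=> yA [[Sa aNU] aI] ya; apply: contrapT => yNa; apply: aI.
exists y, (a - y); split; [by case: yA| |by rewrite /= addrC subrK].
by split=> // /munit_add/eqP; rewrite subr_eq0 => /eqP/esym.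
Qed.

Lemma add_atom_leD y u v : matom add S y -> S u -> S v ->
  y <<= u + v -> y <<= u \/ y <<= v.
Proof.
move=> yA Su Sv /mdvd_add yuv.
by case: (matom_prime hU.1 yA Su Sv yuv) => /mdvd_add; [left|right].
Qed.

Lemma add_atom_leMn y u n : matom add S y -> S u -> y <<= u *+ n -> y <<= u.
Proof.
move=> yA Su; elim: n => [|n IH].
  rewrite mulr0n sub0r => /S_ge0; rewrite oppr_ge0 leNgt.
  by rewrite (add_atom_gt0 yA).
by rewrite mulrS => /(add_atom_leD yA Su (psemiringMn _ Su))[].
Qed.

(** Subtracting [y] repeatedly must stop, because the reals are Archimedean and elements of [S] are
    nonnegative. *)
Lemma add_atom_decomp y x : matom add S y -> S x ->
  exists n t, [/\ S t, x = t + y *+ n & ~ y <<= t].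
Proof.
move=> yA; have y0 := add_atom_gt0 yA.
have [m] : exists m, x < y *+ m.
  exists (Num.truncn (x / y)).+1.
  by rewrite -mulr_natl -ltr_pdivrMr// truncnS_gt.
elim: m x => [|m IH] x; first by rewrite mulr0n ltNge => /negP xN /S_ge0.
move=> xm Sx; have [yx|yNx] := pselect (y <<= x); last first.
  by exists 0%N, x; rewrite mulr0n addr0.
have [|//|n [t [St xE yNt]]] := IH (x - y).
  by rewrite ltrBlDr -mulrSr.
by exists n.+1, t; split=> //; rewrite mulrSr addrA -xE subrK.
Qed.

(** By primality, [y] lies below [t] or below the difference [z]; the first is excluded, so one [y]
    can be taken off [z]. *)
Lemma le_cancel_atom y t t' n : matom add S y -> S t -> S t' -> ~ y <<= t ->
  t <<= t' + y *+ n -> t <<= t'.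
Proof.
move=> yA St St' yNt; have Sy := add_atom_closed yA.
elim: n => [|n IH]; first by rewrite mulr0n addr0.
move=> tt'; set z := (X in S X) in tt'.
have [|//|yz] := add_atom_leD yA St tt'; last first.
  apply: IH; suff -> : t' + y *+ n - t = z - y by [].
  by rewrite /z mulrSr; ring.
have -> : t + z - y = t' + y *+ n by rewrite /z mulrSr; ring.
exact: SD (psemiringMn _ _).
Qed.

Lemma add_atom_sum x : S x -> exists2 s, x = \sum_(a <- s) a &
  forall a, a \in s -> matom add S a /\ a <<= x.
Proof.
move=> Sx; have [->|x0] := eqVneq x 0; first by exists [::]; rewrite ?big_nil.
have [|s [sA xE] _] := hU.1.2 x; first by split=> // /munit_add/eqP; exact/negP.
exists s => // a a_s; split; first exact: sA.
by apply/mdvd_add; rewrite xE; exact: (mdvd_big hU.1 sA).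
Qed.

(* If [1 = b + c] then every atom [a] would split as [a * b + a * c]. *)
Lemma add_atom1 : matom add S 1.
Proof.
(* An atom exists at all because [1] is nonzero, so that its additive factorization is nonempty. *)
have [s sE sA] := add_atom_sum S1.
case: s => [|a s] in sE sA.
  by move: sE => /eqP; rewrite big_nil oner_eq0.
have [aA _] := sA a (mem_head _ _); have Sa := add_atom_closed aA.
split; first by split=> // /munit_add/eqP; rewrite oner_eq0.
move=> [b [c [[Sb b0] [Sc c0] /= bc]]]; case: aA => _; apply.
have aM d : S d -> ~ munit add S d -> mnonunit add S (a * d).
  move=> Sd d0; split; first exact: SM.
  move=> /munit_add/eqP; rewrite mulf_eq0 => /orP[]/eqP; last by move=> /munit_add.
  move=> a0; case: (sA a (mem_head _ _)) => -[[_ +] _] _.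
  by move=> /munit_add.
exists (a * b), (a * c); split; [exact: aM|exact: aM|].
by rewrite /= -mulrDr -bc mulr1.
Qed.

(** * Membership by multiplicative roots, and products of additive atoms *)

(** The real number [q] is not known to lie in [S], but [t ^ 2 * q ^ 2 = (t * q) ^ 2] holds among
    elements of [S], so [t] divides [t * q] there. *)
Lemma psemiring_root t q : S t -> t != 0 -> S (t * q) -> S (q * q) -> S q.
Proof.
move=> St t0 Stq Sqq; have [->//|q0] := eqVneq q 0.
have [||||z [Sz _] /(mulfI t0)-> //] := mdvd_root hU.2 (t:=t) (u:=q * q) (w:=t * q).
- by split=> //; exact/eqP.
- by split=> //; apply/eqP; rewrite mulf_neq0.
- by split=> //; apply/eqP; rewrite mulf_neq0.
by rewrite /=; ring.
Qed.

Lemma sle_trans x y z : x <<= y -> y <<= z -> x <<= z.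
Proof. by move=> xy yz; have := SD xy yz; rewrite addrC addrA subrK. Qed.

(* As [(S, +)] is factorial, [dom u v] says that every additive atom of [u] is
   one of [v]. *)
Let dom u v := exists n : nat, u <<= v *+ n.

Let dom_le u v : u <<= v -> dom u v.
Proof. by exists 1%N. Qed.

Let dom_trans v u w : dom u v -> dom v w -> dom u w.
Proof.
move=> [n uv] [m vw]; exists (m * n)%N; apply: sle_trans uv _.
by rewrite mulrnA -mulrnBl; exact: psemiringMn.
Qed.

Let domD u v w : dom u w -> dom v w -> dom (u + v) w.
Proof.
move=> [n uw] [m vw]; exists (n + m)%N; have := SD uw vw.
by rewrite mulrnDr opprD addrACA.
Qed.

Let domMn u w n : S w -> dom u w -> dom (u *+ n) w.
Proof.
move=> Sw uw; elim: n => [|n IH]; last by rewrite mulrS; exact: domD.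
by exists 0%N; rewrite !mulr0n subr0.
Qed.

Let domM u v u' v' : S u -> S v -> dom u u' -> dom v v' -> dom (u * v) (u' * v').
Proof.
move=> Su Sv [n p] [m q]; exists (n * m)%N.
have -> : u' * v' *+ (n * m) - u * v =
    u * (v' *+ m - v) + (u' *+ n - u) * v + (u' *+ n - u) * (v' *+ m - v).
  by rewrite mulrnA -mulrnAl -mulrnAr; ring.
exact: SD (SD (SM Su q) (SM p Sv)) (SM p q).
Qed.

Let dom_root t y : S t -> t != 0 -> matom add S y -> dom (y * t) (t * t) ->
  y <<= t.
Proof.
move=> St t0 yA [n ytt]; have Sy := add_atom_closed yA.
have SMn u k : S u -> S (u *+ k) by exact: psemiringMn.
have Stt : S (t * t) by exact: SM.
(* With [N = 2 * (n + 1)], the part [N ^ 2 * t ^ 2 - 2 * N * t * y] of the square is [4 * (n + 1)]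
   times [(n + 1) * t ^ 2 - y * t], which lies in [S]. *)
suff q : S (t *+ (2 * n.+1) - y) by exact: add_atom_leMn q.
apply: psemiring_root t0 _ _ => //.
  have -> : t * (t *+ (2 * n.+1) - y) = t * t *+ n.+2 + (t * t *+ n - y * t).
    have -> : (2 * n.+1 = n.+2 + n)%N by rewrite mul2n -addnn addSnnS addnC.
    by rewrite mulrnDr; ring.
  by apply: SD => //; exact: SMn.
have -> : (t *+ (2 * n.+1) - y) * (t *+ (2 * n.+1) - y) =
    (t * t *+ n - y * t + t * t) *+ (4 * n.+1) + y * y.
  by ring.
by apply: SD; [apply/SMn/SD|exact: SM].
Qed.

(** The aim is [dom (y * t) (t * t)] for the part [t] of [s ^ 6] free of [y]: then [dom_root]
    contradicts the choice of [t]. Since [y <<= s ^ 2] and [t <<= s ^ 6], it suffices that [t * t]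
    dominates [s ^ 8]. *)
Lemma add_atom_mul a b y : matom add S a -> matom add S b -> matom add S y ->
  y <<= a * b -> y = 1 \/ y = a \/ y = b.
Proof.
move=> aA bA yA yab; apply: contrapT => yN.
have [Sa Sb Sy] : [/\ S a, S b & S y] by split; exact: add_atom_closed.
have N c : matom add S c -> y <> c -> ~ y <<= c.
  by move=> cA yc /(add_atom_eq yA cA).
have yN1 : ~ y <<= 1 by apply: N add_atom1 _ => ?; apply: yN; left.
have yNa : ~ y <<= a by apply: N aA _ => ?; apply: yN; right; left.
have yNb : ~ y <<= b by apply: N bA _ => ?; apply: yN; right; right.
pose s := 1 + a + b.
have Ss : S s by do !apply: SD.
have SX n : S (s ^+ n) by exact: psemiringX.
have sX_le m n : (m <= n)%N -> s ^+ m <<= s ^+ n.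
  move=> /subnK <-; elim: (n - m)%N => [|k IH]; first by rewrite subrr.
  apply: sle_trans IH _; rewrite addSn exprS.
  have -> : s * s ^+ (k + m) - s ^+ (k + m) = (a + b) * s ^+ (k + m).
    by rewrite /s; ring.
  by apply: SM => //; exact: SD.
have yss : dom y (s ^+ 2).
  apply: dom_le; apply: sle_trans yab _.
  have -> : s ^+ 2 - a * b = 1 + a + a + b + b + a * a + b * b + a * b.
    by rewrite /s; ring.
  by do !(apply: SM || apply: SD).
(* Besides [t], the part [u] of [s ^ 4] free of [y] is needed, because [s ^ 8] is expanded as the
   square of [s ^ 4]; [u] is dominated by [t]. *)
have [n [u [Su s4 yNu]]] := add_atom_decomp yA (SX 4%N).
have [m [t [St s6 yNt]]] := add_atom_decomp yA (SX 6%N).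
have le_t z : S z -> ~ y <<= z -> z <<= s ^+ 6 -> dom z t.
  move=> Sz yNz; rewrite s6 => zt; apply: dom_le.
  exact: le_cancel_atom yA _ _ _ zt.
have s_s6 : s <<= s ^+ 6 by exact: (sX_le 1%N).
have t1 : dom 1 t by apply: le_t => //; exact: (sX_le 0%N).
have ta : dom a t.
  apply: le_t => //; apply: sle_trans s_s6.
  by rewrite /s addrAC addrK; exact: SD.
have tb : dom b t.
  apply: le_t => //; apply: sle_trans s_s6.
  by rewrite /s addrK; exact: SD.
have tu : dom u t.
  apply: le_t => //; apply: sle_trans (sX_le 4%N 6%N isT).
  by rewrite s4 addrC addKr; exact: psemiringMn.
have ytt : dom y (t * t).
  by apply: (dom_trans (dom_le yab)); exact: domM.
have ttt : dom t (t * t).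
  by rewrite -{1}[t]mulr1; apply: domM => //; apply: dom_le; rewrite subrr.
have Stt : S (t * t) by exact: SM.
have s6tt : dom (s ^+ 6) (t * t) by rewrite s6; apply: domD => //; exact: domMn.
have s4_s4 : dom (s ^+ 4) (s ^+ 4) by apply: dom_le; rewrite subrr.
have us4 : dom u (s ^+ 4).
  by apply: dom_le; rewrite s4 addrC addKr; exact: psemiringMn.
(* In [(u + n * y) ^ 2], the term [u * u] is dominated by [t * t] directly. The terms [u * y] and
   [y * y] are dominated by [s ^ 4 * s ^ 2 = s ^ 6], which [t * t] dominates because it dominates
   both [t] and [y]. *)
have s8tt : dom (s ^+ 8) (t * t).
  have -> : s ^+ 8 = u * u + u * y *+ (2 * n) + y * y *+ (n * n).
    by rewrite (exprD _ 4 4) s4; ring.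
  apply: domD; first apply: domD; first exact: domM.
    apply: domMn => //; apply: dom_trans s6tt.
    by rewrite (exprD _ 4 2); exact: domM.
  apply: domMn => //; apply: dom_trans s6tt.
  rewrite (exprD _ 4 2); apply: domM => //.
  by apply: (dom_trans yss); apply: dom_le; exact: sX_le.
case: yNt; apply: dom_root => //.
  apply/eqP => t0; case: t1 => k; rewrite t0 mul0rn sub0r => /S_ge0.
  by rewrite oppr_ge0 leNgt ltr01.
apply: dom_trans s8tt; rewrite (exprD _ 2 6).
apply: domM => //; apply: dom_le.
by rewrite s6 addrC addKr; exact: psemiringMn.
Qed.

(** * Coordinates in terms of additive atoms; at most one atom besides 1 *)

Lemma sum_natmul2 (a b : R) s : (forall c, c \in s -> c = 1 \/ c = a \/ c = b) ->
  exists i j k, \sum_(c <- s) c = i%:R + a *+ j + b *+ k.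
Proof.
elim: s => [|c s IH] sE.
  by exists 0%N, 0%N, 0%N; rewrite big_nil !mulr0n !addr0.
have [d d_s|i [j [k e]]] := IH; first by apply: sE; rewrite inE d_s orbT.
rewrite big_cons e.
have [->|[->|->]] := sE c (mem_head _ _).
- by exists i.+1, j, k; rewrite -natr1; ring.
- by exists i, j.+1, k; rewrite mulrS; ring.
- by exists i, j, k.+1; rewrite mulrS; ring.
Qed.

Lemma add_atom_mulE a b : matom add S a -> matom add S b ->
  exists i j k, a * b = i%:R + a *+ j + b *+ k.
Proof.
move=> aA bA; have [|s abE sA] := @add_atom_sum (a * b).
  by apply: SM; exact: add_atom_closed.
have [|i [j [k e]]] := @sum_natmul2 a b s.
  by move=> c /sA[cA cab]; exact: add_atom_mul.
by exists i, j, k; rewrite abE.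
Qed.

(** Cancelling [y] in both directions gives [t <<= t'] and [t' <<= t], and [<<=] is antisymmetric
    because it refines the order of the reals. *)
Lemma add_atom_coef y t t' n n' : matom add S y -> S t -> S t' ->
  ~ y <<= t -> ~ y <<= t' -> t + y *+ n = t' + y *+ n' -> t = t' /\ n = n'.
Proof.
move=> yA St St' yNt yNt' e; suff tt' : t = t'.
  split=> //; move: e; rewrite tt' => /addrI/eqP.
  by rewrite -subr_eq0 -mulr_natl -[X in _ - X]mulr_natl -mulrBl mulf_eq0
    (negbTE (add_atom_neq0 yA)) orbF subr_eq0 eqr_nat => /eqP.
apply/eqP; rewrite eq_le -subr_ge0 -[X in _ && X]subr_ge0.
have le1 : t <<= t'.
  apply: (le_cancel_atom (n := n') yA) => //; rewrite -e addrC addKr.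
  exact: psemiringMn _ (add_atom_closed yA).
have le2 : t' <<= t.
  apply: (le_cancel_atom (n := n) yA) => //; rewrite e addrC addKr.
  exact: psemiringMn _ (add_atom_closed yA).
by rewrite (S_ge0 le1) (S_ge0 le2).
Qed.

Lemma add_atom_Nle y x n m : matom add S y -> matom add S x -> y <> 1 ->
  y <> x -> ~ y <<= n%:R + x *+ m.
Proof.
move=> yA xA y1 yx; have Sx := add_atom_closed xA.
move=> /(add_atom_leD yA (psemiringMn n S1) (psemiringMn m Sx))[].
  by move=> /(add_atom_leMn yA S1)/(add_atom_eq yA add_atom1).
by move=> /(add_atom_leMn yA Sx)/(add_atom_eq yA xA).
Qed.

Lemma natr_closed n : S n%:R. Proof. exact: psemiringMn. Qed.

(** Allows comparison of coefficients with respect to [1] and [x], although no irrationality of [x]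
    is known at this point. *)
Lemma lin_coef x i j i' j' : matom add S x -> x <> 1 ->
  i%:R + x *+ j = i'%:R + x *+ j' -> i = i' /\ j = j'.
Proof.
move=> xA x1 /(add_atom_coef xA (natr_closed i) (natr_closed i'))[].
- by move=> /(add_atom_leMn xA S1)/(add_atom_eq xA add_atom1).
- by move=> /(add_atom_leMn xA S1)/(add_atom_eq xA add_atom1).
by move=> /eqP; rewrite eqr_nat => /eqP.
Qed.

Lemma lin_coef3 x y i j k i' j' k' : matom add S x -> matom add S y ->
  x <> 1 -> y <> 1 -> y <> x ->
  i%:R + x *+ j + y *+ k = i'%:R + x *+ j' + y *+ k' ->
  [/\ i = i', j = j' & k = k'].
Proof.
move=> xA yA x1 y1 yx; have Sx := add_atom_closed xA.
move=> /(add_atom_coef yA)[||||/(lin_coef xA x1)[-> ->] ->//].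
- exact: SD (natr_closed _) (psemiringMn _ _).
- exact: SD (natr_closed _) (psemiringMn _ _).
- exact: add_atom_Nle.
- exact: add_atom_Nle.
Qed.

Lemma add_atom_sqr x : matom add S x -> exists i j, x * x = i%:R + x *+ j.
Proof.
move=> xA; have [i [j [k e]]] := add_atom_mulE xA xA.
by exists i, (j + k)%N; rewrite e mulrnDr addrA.
Qed.

(* Otherwise [1, x, y] would span a cubic field containing the quadratic field
   [Q(x)]. *)
Lemma add_atom_uniq x y : matom add S x -> matom add S y ->
  x <> 1 -> y <> 1 -> y = x.
Proof.
move=> xA yA x1 y1; apply: contrapT => yx.
have [al [be x2]] := add_atom_sqr xA.
have [c [d [e xy]]] := add_atom_mulE xA yA.
(* The two triples are the coordinates of [(x * x) * y] and [x * (x * y)]. *)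
have [] := @lin_coef3 x y (c * be) (d * be) (al + be * e) (d * al + e * c)
  (c + d * be + e * d) (e * e) xA yA x1 y1 yx.
  suff E : x * (x * y) = (x * x) * y.
    rewrite {1}xy x2 in E.
    have E1 : x * (c%:R + x *+ d + y *+ e) =
        x *+ c + (x * x) *+ d + (x * y) *+ e by ring.
    have E2 : (al%:R + x *+ be) * y = y *+ al + (x * y) *+ be by ring.
    rewrite E1 E2 x2 xy in E.
    have F : (c * be)%:R + x *+ (d * be) + y *+ (al + be * e) =
        y *+ al + (c%:R + x *+ d + y *+ e) *+ be by ring.
    rewrite F -E; ring.
  by ring.
move=> _ E2 _.

(* The coefficients of [x] give [d * be = c + d * be + e * d]. If [e = 0] then [y = d], and if
   [d = 0] then [x = e]; an atom other than [1] is not a natural number. *)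
have [c0 ed0] : c = 0%N /\ (e * d = 0)%N by lia.
have {}xy : x * y = x *+ d + y *+ e by rewrite xy c0 add0r.
move: ed0 => /eqP; rewrite muln_eq0 => /orP[]/eqP z0; rewrite {}z0 !mulr0n in xy.
  have yd : y = d%:R.
    apply: (mulfI (add_atom_neq0 xA)); rewrite xy; ring.
  have := @add_atom_Nle y x d 0 yA xA y1 yx.
  by rewrite mulr0n addr0 -yd subrr.
have xe : x = e%:R.
  apply: (mulIf (add_atom_neq0 yA)); rewrite xy; ring.
have := @add_atom_Nle x y e 0 xA yA x1 (nesym yx).
by rewrite mulr0n addr0 -xe subrr.
Qed.

Lemma lin_closed x i j : S x -> S (i%:R + x *+ j).
Proof. by move=> Sx; apply: SD; exact: psemiringMn. Qed.

(* If [x] occurs in [x * x], then [q = 2 * x - 1] has [x * q] and [q * q] in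
   [S]. *)
Lemma add_atom_sqr_nat x : matom add S x -> x <> 1 ->
  exists n, x * x = n%:R.
Proof.
move=> xA x1; have Sx := add_atom_closed xA.
have [al [[|be] x2]] := add_atom_sqr xA.
  by exists al; rewrite x2 mulr0n addr0.
(* Once [2 * x - 1] is in [S], [1 <<= 2 * x] yields [1 <<= x], and comparable atoms are equal. *)
case: x1; apply/esym/(add_atom_eq add_atom1 xA).
apply: (add_atom_leMn (n := 2) add_atom1 Sx).
apply: (psemiring_root Sx (add_atom_neq0 xA)).
  have -> : x * (x *+ 2 - 1) = (al * 2)%:R + x *+ (be * 2).+1.
    have -> : x * (x *+ 2 - 1) = (x * x) *+ 2 - x by ring.
    by rewrite x2; ring.
  exact: lin_closed.
have -> : (x *+ 2 - 1) * (x *+ 2 - 1) = (al * 4).+1%:R + x *+ (be * 4).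
  have -> : (x *+ 2 - 1) * (x *+ 2 - 1) = (x * x) *+ 4 - x *+ 4 + 1 by ring.
  by rewrite x2; ring.
exact: lin_closed.
Qed.

(** * Multiplicative arithmetic when a second additive atom exists *)

Lemma add_atom_lin x z : matom add S x -> x <> 1 -> S z ->
  exists i j, z = i%:R + x *+ j.
Proof.
move=> xA x1 Sz; have [s zE sA] := add_atom_sum Sz.
have [|i [j [k e]]] := @sum_natmul2 x x s.
  move=> c /sA[cA _]; have [|c1] := pselect (c = 1); first by left.
  by right; left; exact: (add_atom_uniq xA cA x1 c1).
by exists i, (j + k)%N; rewrite zE e mulrnDr addrA.
Qed.

Lemma lin_mul (x : R) n a b c d : x * x = n%:R ->
  (a%:R + x *+ b) * (c%:R + x *+ d) =
  (a * c + b * d * n)%:R + x *+ (a * d + b * c).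
Proof.
move=> x2.
have -> : (a%:R + x *+ b) * (c%:R + x *+ d) =
  (a * c)%:R + (x * x) *+ (b * d) + x *+ (a * d + b * c) by ring.
by rewrite x2; ring.
Qed.

Lemma munit_mul_nat x n : matom add S x -> x <> 1 -> x * x = n%:R ->
  forall l, munit mul (S `\ 0) l%:R -> l = 1%N.
Proof.
move=> xA x1 x2 l [_ [y [Sy _] /= ly]].
have [i [j yE]] := add_atom_lin xA x1 Sy.
have : l%:R + x *+ 0 = l%:R :> R by rewrite mulr0n addr0.
move: ly; rewrite yE => + lE; rewrite -lE (lin_mul _ _ _ _ x2) => ly.
have [|e1 _] := @lin_coef x (l * i + 0 * j * n) (l * j + 0 * i) 1 0 xA x1.
  by rewrite ly mulr0n addr0.
by move: e1 => /eqP; rewrite !mul0n addn0 muln_eq1 => /andP[/eqP].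
Qed.

(** If [l = (a + b * x) * (c + d * x)], then [a * d + b * c = 0]. For [b = d = 0] this is a
    factorization of a prime in the naturals; if exactly one of [b], [d] vanishes, then [l = 0]; if
    neither does, then [a = c = 0] and [l = b * d * n]. *)
Lemma mul_atom_prime x n l : matom add S x -> x <> 1 -> x * x = n%:R ->
  prime l -> ~~ (n %| l)%N -> matom mul (S `\ 0) l%:R.
Proof.
move=> xA x1 x2 l_pr nl; have l_gt1 := prime_gt1 l_pr.
have munit1 : munit mul (S `\ 0) (1 : R).
  have M1 : (S `\ 0) (1 : R) by split=> //; apply/eqP; rewrite oner_eq0.
  by split=> //; exists 1 => //=; rewrite mulr1.
split.
  split; first split; first exact: natr_closed.
    by apply/eqP; rewrite pnatr_eq0 -lt0n prime_gt0.
  by move=> /(munit_mul_nat xA x1 x2) l1; rewrite l1 in l_gt1.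
move=> [y [z [[[Sy _] yNU] [[Sz _] zNU] /=]]].
have [a [b yE]] := add_atom_lin xA x1 Sy.
have [c [d zE]] := add_atom_lin xA x1 Sz.
rewrite yE zE (lin_mul _ _ _ _ x2) => lE.
have [] := @lin_coef x l 0 (a * c + b * d * n) (a * d + b * c) xA x1.
  by rewrite mulr0n addr0.
move=> {}lE /esym/eqP; rewrite addn_eq0 !muln_eq0.
have [b0|b0] := posnP b; have [d0|d0] := posnP d.
- subst b d; move: lE; rewrite mul0n mul0n addn0 => lE _.
  have al : (a %| l)%N by rewrite lE dvdn_mulr.
  have [a1|a1] := eqVneq a 1%N; first by case: yNU; rewrite yE a1 mulr0n addr0.
  move: al => /(prime_nt_dvdP l_pr a1) al.
  case: zNU; rewrite zE mulr0n addr0; suff -> : c = 1%N by [].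
  by apply/eqP; rewrite -(eqn_pmul2l (prime_gt0 l_pr)) -{1}al -lE muln1.
- by subst b; rewrite orbF => /andP[/eqP a0 _]; move: l_gt1; rewrite lE a0.
- subst d; move=> /andP[_ /eqP c0]; move: l_gt1.
  by rewrite lE c0 !muln0.
rewrite orbF => /andP[/eqP a0 /eqP c0].
by move: nl; rewrite lE a0 mul0n add0n dvdn_mull.
Qed.

(* With [x * x = n] and a prime divisor [l] of [n ^ 2 + n + 1], the atom [l]
   divides [(n + 1 + x) * ((l - 1) * (n + 1) + x)] but neither factor, as [x]
   has coefficient [1] in both. *)
Lemma add_atom_eq1 x : matom add S x -> x = 1.
Proof.
move=> xA; apply: contrapT => x1; have Sx := add_atom_closed xA.
have x0 := add_atom_gt0 xA.
have [n x2] := add_atom_sqr_nat xA x1.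
have n0 : (0 < n)%N by rewrite -(ltr0n R) -x2 mulr_gt0.
have n1 : n != 1%N.
  apply/eqP => n1; apply: x1; apply/eqP.
  by rewrite -(eqrXn2 (n := 2))// ?ltW// expr2 x2 n1 expr1n.
have [l l_pr l_dvd] : exists2 l, prime l & (l %| n * n + n + 1)%N.
  by exists (pdiv (n * n + n + 1)); [apply: pdiv_prime; lia|exact: pdiv_dvd].
have l_gt1 := prime_gt1 l_pr; have /dvdnP[q lq] := l_dvd.
(* Otherwise [n = l], and [l] would divide [1 = (n ^ 2 + n + 1) - (n ^ 2 + n)]. *)
have nl : ~~ (n %| l)%N.
  apply/negP => /(prime_nt_dvdP l_pr n1) nl.
  have : (l %| 1)%N.
    by rewrite -(@dvdn_addr (n * n + n))// nl dvdn_add// dvdn_mull.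
  by rewrite dvdn1 => /eqP l1; rewrite l1 in l_gt1.
have lA := mul_atom_prime xA x1 x2 l_pr nl.
(* Ensures that the truncated subtraction in the cofactor below is a true one. *)
have qn : (q <= n.+1 * n.+1)%N by nia.
have lin_neq0 i : i%:R + x *+ 1 != 0 by rewrite lt0r_neq0// ltr_wpDl.
have fM i : (S `\ 0) (i%:R + x *+ 1) by split; [exact: lin_closed|apply/eqP].
have l_ndvd i : ~ mdvd mul (S `\ 0) l%:R (i%:R + x *+ 1).
  move=> [z [Sz _] /=]; have [a [b ->]] := add_atom_lin xA x1 Sz.
  have -> : l%:R * (a%:R + x *+ b) = (l * a)%:R + x *+ (l * b) by ring.
  move=> /(lin_coef xA x1)[_ /esym/eqP].
  by rewrite muln_eq1 (gtn_eqF l_gt1).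
(* The product [(x + n + 1) * (x - n - 1)] is [- (n ^ 2 + n + 1) = - l * q]. Adding [l * (n + 1)] to
   the second factor makes its coefficients nonnegative and the cofactor of [l] equal to
   [(n + 1) ^ 2 - q + (n + 1) * x]. *)
case: (matom_prime hU.2 lA (fM n.+1) (fM (l.-1 * n.+1)%N)); [|exact: l_ndvd..].
exists ((n.+1 * n.+1 - q)%N%:R + x *+ n.+1).
  split; first exact: lin_closed.
  by apply/eqP; rewrite lt0r_neq0// ltr_wpDl// pmulrn_lgt0.
rewrite /= (lin_mul _ _ _ _ x2).
have -> : l%:R * ((n.+1 * n.+1 - q)%:R + x *+ n.+1) =
  (l * (n.+1 * n.+1 - q))%:R + x *+ (l * n.+1) by ring.
by congr (_%:R + x *+ _); nia.
Qed.

(** With [1] as the only additive atom, each element is the length of its additive factorization. *)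
Lemma bi_UFS_nat : S = range (fun n : nat => n%:R : R).
Proof.
rewrite eqEsubset; split=> [z Sz|_ [n _ <-]]; last exact: natr_closed.
have [s zE sA] := add_atom_sum Sz; exists (size s) => //.
rewrite zE big_seq (eq_bigr (fun=> 1)); last by move=> c /sA[/add_atom_eq1].
by rewrite -big_seq big_const_seq count_predT iter_addr_0.
Qed.

End BiUFS.

(** * The natural numbers form a bi-UFS *)

Section Naturals.
Context {R : realType}.
Local Notation N := (range (fun n : nat => n%:R : R)).
Local Notation add := (+%R : Monoid.com_law (0 : R)).
Local Notation mul := ( *%R : Monoid.com_law (1 : R)).

Lemma perm_same_factorization (T : eqType) (e : T) (op : Monoid.com_law e)
  (M : set T) s t : M e -> perm_eq s t -> same_factorization op M s t.
Proof.
move=> Me st; exists t; split=> // i _; exists e; last by rewrite Monoid.mul1m.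
by split=> //; exists e; rewrite ?Monoid.mul1m.
Qed.

Lemma munit_add_nat n : munit add N n%:R <-> n = 0%N.
Proof.
split=> [[_ [_ [m _ <-] /= /eqP]]|->].
  by rewrite -natrD pnatr_eq0 addn_eq0 => /andP[/eqP].
by split; [exists 0%N|exists 0; [exists 0%N|rewrite /= addr0]].
Qed.

Lemma matom_add_nat a : matom add N a <-> a = 1.
Proof.
split=> [[[[n _ <-] nNU] nI]|->].
  case: n => [|[|n]]// in nNU nI *; first by case: nNU; exact/munit_add_nat.
  case: nI; exists 1%:R, n.+1%:R; split; last by rewrite /= -natrD.
    by split; [exists 1%N|move=> /munit_add_nat].
  by split; [exists n.+1|move=> /munit_add_nat].
split; first by split; [exists 1%N|move=> /(munit_add_nat 1)].
move=> [_ [_ [[[i _ <-] iNU] [[j _ <-] jNU] /= /eqP]]].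
rewrite -natrD eq_sym pnatr_eq1 => /eqP.
case: i iNU => [[]|i _]; first exact/munit_add_nat.
by case: j jNU => [[]|j _]; [exact/munit_add_nat|lia].
Qed.

(** As [1] is the only atom, a factorization is determined by its length, and the length is the
    number itself. *)
Lemma UFM_add_nat : UFM add N.
Proof.
split.
  split; first by exists 0%N.
    by move=> _ _ [i _ <-] [j _ <-]; exists (i + j)%N; rewrite //= natrD.
  by move=> x y z _ _ _ /addrI.
move=> _ [[n _ <-] _]; exists (nseq n 1).
  split=> [a /nseqP[-> _]|]; first exact/matom_add_nat.
  by rewrite big_nseq iter_addr_0.
move=> t [tA tE]; have : t = nseq (size t) 1.
  by apply/all_pred1P/allP => a /tA/matom_add_nat ->; rewrite inE.
move: tE => + tE; rewrite tE big_nseq iter_addr_0 => /eqP.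
rewrite eqr_nat => /eqP <-; apply: perm_same_factorization => //.
by exists 0%N.
Qed.

Lemma nat_pos_closed n : (0 < n)%N -> (N `\ 0) (n%:R : R).
Proof. by move=> n0; split; [exists n|apply/eqP; rewrite pnatr_eq0 -lt0n]. Qed.

Lemma nat_posP x : (N `\ 0) x -> exists2 n, (0 < n)%N & x = n%:R.
Proof.
by move=> [[n _ <-] /eqP]; rewrite pnatr_eq0 -lt0n; exists n.
Qed.

Lemma munit_mul_natP n : munit mul (N `\ 0) n%:R <-> n = 1%N.
Proof.
split=> [[_ [_ /nat_posP[m _ ->] /= /eqP]]|->].
  by rewrite -natrM pnatr_eq1 muln_eq1 => /andP[/eqP].
by split; [exact: nat_pos_closed|exists 1; [exact: (@nat_pos_closed 1)|rewrite /= mulr1]].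
Qed.

Lemma matom_mul_nat n : matom mul (N `\ 0) n%:R <-> prime n.
Proof.
split=> [[[/nat_posP[m n0 /eqP]]]|n_pr].
  rewrite eqr_nat => /eqP nm; rewrite -{m}nm in n0 => nNU nI.
  apply/primeP; split.
    by rewrite ltn_neqAle n0 andbT; apply/eqP => n1; apply: nNU; exact/munit_mul_natP.
  move=> d /dvdnP[k nE]; apply: contrapT => /negP; rewrite negb_or => /andP[d1 dn].
  case: nI; exists d%:R, k%:R; rewrite nE /= -natrM mulnC.
  move: n0; rewrite nE muln_gt0 => /andP[k0 d0].
  split=> //; split; try exact: nat_pos_closed.
    by move=> /munit_mul_natP/eqP; rewrite (negbTE d1).
  by move=> /munit_mul_natP k1; move: dn; rewrite nE k1 mul1n eqxx.
split.
  split; first exact: nat_pos_closed (prime_gt0 n_pr).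
  by move=> /munit_mul_natP n1; rewrite n1 in n_pr.
move=> [_ [_ [[/nat_posP[i _ ->] iNU] [/nat_posP[j _ ->] jNU] /= /eqP]]].
rewrite -natrM eqr_nat => /eqP nE.
have [i1|i1] := eqVneq i 1%N; first by apply: iNU; exact/munit_mul_natP.
have /(prime_nt_dvdP n_pr i1) iE : (i %| n)%N by rewrite nE dvdn_mulr.
 apply: jNU; apply/munit_mul_natP.
by have := prime_gt0 n_pr; nia.
Qed.

Lemma exists_prime_seq n : (0 < n)%N ->
  exists2 r, all prime r & n = (\prod_(p <- r) p)%N.
Proof.
elim/ltn_ind: n => n IH n0; have [n1|n1] := leqP n 1.
  by exists [::]; rewrite // big_nil; lia.
have p_pr := pdiv_prime n1.
have [||r r_pr rE] := IH (n %/ pdiv n)%N.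
- by rewrite ltn_Pdiv// prime_gt1.
- by rewrite divn_gt0 ?prime_gt0// dvdn_leq// pdiv_dvd.
exists (pdiv n :: r); first by rewrite /= p_pr.
by rewrite big_cons -rE mulnC divnK// pdiv_dvd.
Qed.

Lemma prime_seq_prod_gt0 r : all prime r -> (0 < \prod_(p <- r) p)%N.
Proof.
move=> /allP r_pr; rewrite big_seq; elim/big_rec: _ => // p m /r_pr/prime_gt0 p0 m0.
by rewrite muln_gt0 p0.
Qed.

(** The valuation depends on the product alone, so multiplicities in a prime factorization are
    determined by it. *)
Lemma count_prime_seq p r : prime p -> all prime r ->
  count_mem p r = logn p (\prod_(q <- r) q)%N.
Proof.
move=> p_pr; elim: r => [|q r IH] /=; first by rewrite big_nil logn1.
move=> /andP[q_pr r_pr].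
rewrite big_cons lognM ?(prime_gt0 q_pr) ?prime_seq_prod_gt0// -IH//.
by rewrite logn_prime// [q == p]eq_sym.
Qed.

Lemma perm_prime_seq r r' : all prime r -> all prime r' ->
  (\prod_(p <- r) p = \prod_(p <- r') p)%N -> perm_eq r r'.
Proof.
move=> r_pr r_pr' e; apply/allP => p; rewrite mem_cat => pr /=.
have p_pr : prime p by case/orP: pr; [exact: allP p|exact: allP p].
by rewrite !count_prime_seq// e.
Qed.

Lemma UFM_mul_nat : UFM mul (N `\ 0).
Proof.
split.
  split; first exact: (@nat_pos_closed 1).
    move=> _ _ /nat_posP[i i0 ->] /nat_posP[j j0 ->] /=; rewrite -natrM.
    by apply: nat_pos_closed; rewrite muln_gt0 i0.
  by move=> x y z [_ /eqP x0] _ _ /(mulfI x0).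
move=> _ [/nat_posP[n n0 ->] _].
have [r r_pr rE] := exists_prime_seq n0; exists [seq p%:R | p <- r].
  split; last by rewrite big_map {1}rE natr_prod.
  by move=> _ /mapP[p /(allP r_pr) p_pr ->]; exact/matom_mul_nat.
move=> t [tA tE].
(* A factorization into real atoms is pulled back to a sequence of prime naturals, where uniqueness
   is available. *)
have [r' r_pr' tr] : exists2 r', all prime r' & t = [seq p%:R | p <- r'].
  elim: t tA {tE} => [|a t IH] tA; first by exists [::].
  have [|r' r_pr' ->] := IH.
    by move=> c c_t; apply: tA; rewrite inE c_t orbT.
  have aA := tA a (mem_head _ _); have [[/nat_posP[p _ aE] _] _] := aA.
  exists (p :: r'); last by rewrite aE.
  by rewrite /= r_pr' andbT; apply/matom_mul_nat; rewrite -aE.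
rewrite tr; apply: perm_same_factorization; first exact: (@nat_pos_closed 1).
apply/perm_map/perm_prime_seq => //; rewrite -rE; apply/eqP.
by rewrite -(eqr_nat R) tE tr big_map natr_prod.
Qed.

End Naturals.

Theorem theorem4p3 (R : realType) (S : set R) (hS : positive_semiring S) :
  bi_UFS S <-> S = range (fun n : nat => n%:R : R).
Proof.
split=> [|->]; first exact: bi_UFS_nat.
by split; [exact: UFM_add_nat|exact: UFM_mul_nat].
Qed.
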